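(* A large finitary coarse space $(X,\mathcal E)$ cannot be cellular.
   Context: An entourage on a set $X$ is a set $E\subseteq X\times X$ containing the diagonal $\Delta_X=\{(x,x):x\in X\}$; $E^{-1}=\{(y,x):(x,y)\in E\}$, $EF=\{(x,z):\exists y\in X\ (x,y)\in E,\ (y,z)\in F\}$, $E(x)=\{y\in X:(x,y)\in E\}$, $E[A]=\bigcup_{a\in A}E(a)$. A coarse space is a pair $(X,\mathcal E)$ consisting of a set $X$ and a coarse structure $\mathcal E$ on $X$, i.e. a family $\mathcal E$ of entourages on $X$ such that $\bigcup\mathcal E=X\times X$; for any $E,F\in\mathcal E$ there is $T\in\mathcal E$ with $EF^{-1}\subseteq T$; and every entourage contained in a member of $\mathcal E$ belongs to $\mathcal E$. A base of $\mathcal E$ is a subfamily $\mathcal B\subseteq\mathcal E$ such that each $E\in\mathcal E$ is contained in some $B\in\mathcal B$. The coarse space is finitary if $\sup_{x\in X}|E(x)|$ is finite for every $E\in\mathcal E$; it is cellular if $\mathcal E$ has a base consisting of cellular entourages, i.e. of equivalence relations on $X$. A set $A\subseteq X$ is $\mathcal E$-bounded if $A\subseteq E(x)$ for some $E\in\mathcal E$ and $x\in X$, and $\mathcal E$-unbounded otherwise. The coarse space is unbounded if $X$ is $\mathcal E$-unbounded. An unbounded coarse space is large if for every $\mathcal E$-unbounded set $A\subseteq X$ there is $E\in\mathcal E$ with $E[A]=X$.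
   Formalization: The set X is assumed to be non-empty; with the definitions taken literally, the empty coarse space would be unbounded, large, finitary and cellular, so the claim fails for it. *)

(* Defs.v *)
From Stdlib Require RelationClasses.
From mathcomp Require Import all_boot.
From mathcomp Require Import all_classical.

Set Implicit Arguments.
Unset Strict Implicit.
Unset Printing Implicit Defensive.

Local Open Scope classical_set_scope.
Local Open Scope card_scope.
Local Open Scope relation_scope.

Section CoarseSpaces.
Variable X : Type.
Implicit Types (E F T B : set (X * X)) (EE BB : set (set (X * X))) (A : set X).

Definition is_entourage E := diagonal `<=` E.

(* E(x) is the library's [xsection E x]. *)
Definition ent_image E A : set X := \bigcup_(a in A) xsection E a.

(* Pitfall: MathComp's [B \; A] relates x to y when A (x, z) and B (z, y) for
   some z, so the product E F^{-1}, in which E comes first, is [F^-1 \; E]. *)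
Record coarse_structure EE : Prop := CoarseStructure {
  coarse_entourage : forall E, EE E -> is_entourage E;
  coarse_cover : \bigcup_(E in EE) E = [set: X * X];
  coarse_comp_inv : forall E F, EE E -> EE F ->
    exists2 T, EE T & F^-1 \; E `<=` T;
  coarse_subset : forall E F, EE E -> is_entourage F -> F `<=` E -> EE F
}.

Definition is_base BB EE :=
  BB `<=` EE /\ forall E, EE E -> exists2 B, BB B & E `<=` B.

Definition finitary EE :=
  forall E, EE E -> exists n : nat, forall x, xsection E x #<= `I_n.

Definition cellular_entourage E :=
  RelationClasses.Equivalence (fun x y => E (x, y)).

Definition cellular EE :=
  exists2 BB, is_base BB EE & forall B, BB B -> cellular_entourage B.

Definition bounded EE A := exists2 E, EE E & exists x, A `<=` xsection E x.

Definition large EE :=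
  ~ bounded EE [set: X] /\
  forall A, ~ bounded EE A -> exists2 E, EE E & ent_image E A = [set: X].

End CoarseSpaces.

(* Main.v *)
Require Import Defs.
From mathcomp Require Import all_boot.
From mathcomp Require Import all_classical.

(** Suppose the space is cellular. Every infinite set is unbounded, since the
   balls are finite, so largeness and cellularity give, for each infinite A, an
   equivalence relation B in the coarse structure whose classes have at most n
   points and all meet A ([large_cellularly_dense]). Heuristically A then has
   density at least 1/n, while finite sets have density zero.

   Now X contains uncountably many infinite sets with pairwise finite
   intersections: index the nodes of the binary tree by distinct points of X and
   take the branches ([infinite_prefixes], [prefixes_almost_disjoint]). By the
   pigeonhole principle ([uncountable_infinite_fiber]) infinitely many branches
   share the same n, and n + 1 almost disjoint sets of density at least 1/n
   should not fit into X.

   The last step needs no density ([no_almost_disjoint_dense]). Let B be an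
   equivalence relation in the coarse structure coarser than the n + 1
   relations attached to the chosen sets A_i. Its classes are finite and X is
   infinite, so some class C of B avoids the finite set of points lying in two of
   the A_i. The class C is a union of classes of the i-th relation, each having at
   most n points and meeting A_i, so |A_i `&` C| >= |C| / n. These n + 1 subsets
   of C are disjoint, which is absurd. *)

Set Implicit Arguments.
Unset Strict Implicit.

Local Open Scope classical_set_scope.
Local Open Scope card_scope.

(** Turns a comparison of cardinals into a plain function on the ambient types;
   [u0] is its value outside [A]. *)
Lemma card_le_injection (T U : Type) (u0 : U) (A : set T) (B : set U) :
  A #<= B ->
  exists f : T -> U, [/\ forall x, A x -> B (f x)
    & forall x y, A x -> A y -> f x = f y -> x = y].
Proof.
case/card_leP => f.
pose g x := if pselect (A x) is left Ax then val (f (exist _ x (mem_set Ax)))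
            else u0.
exists g; split=> [x Ax|x y Ax Ay]; rewrite /g.
  by case: pselect => // Ax'; exact: set_valP.
case: pselect => // Ax'; case: pselect => // Ay' /val_inj.
by move/(@inj _ _ _ f); rewrite !in_setT => /(_ isT isT) [].
Qed.

(** The axioms bound products E F^-1 only. Multiplying by the diagonal first
   gives a bound T1 of the inverse of T, and then F T1^-1 contains both F and
   T. *)
Lemma coarse_upper_bound (X : Type) (EE : set (set (X * X)))
    (F : nat -> set (X * X)) (n : nat) :
  coarse_structure EE -> (forall i, EE (F i)) ->
  exists2 T, EE T & forall i, i < n.+1 -> F i `<=` T.
Proof.
move=> [diagE _ compE subE] EEF.
have EEd : EE (diagonal : set (X * X)).
  by apply: (subE (F 0)) => //; exact: diagE.
elim: n => [|n [T ET TF]].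
  by exists (F 0) => // i; rewrite ltnS leqn0 => /eqP ->.
have [T1 ET1 sT1] := compE _ _ EEd ET.
have [T2 ET2 sT2] := compE _ _ (EEF n.+1) ET1.
exists T2 => // i; rewrite ltnS leq_eqVlt => /predU1P[->|lt_in] -[x y] Fxy.
  by apply: sT2; exists y => //; apply: (diagE _ ET1); rewrite /diagonal.
apply: sT2; exists x; first by apply: (diagE _ (EEF _)); rewrite /diagonal.
apply: sT1; exists y; first by rewrite /diagonal.
exact: TF Fxy.
Qed.

(** Each point is related to [x0] by some entourage because the coarse structure
   covers the square of X; finitely many entourages have a common
   bound. *)
Lemma finite_bounded (X : Type) (EE : set (set (X * X))) (x0 : X) (A : set X) :
  coarse_structure EE -> finite_set A -> bounded EE A.
Proof.
move=> cE /finite_setP[m /card_eqPle[/(card_le_injection 0)[k [km kinj]] _]].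
have pairE x : exists2 E, EE E & E (x0, x).
  have : [set: X * X] (x0, x) := I.
  by rewrite -(coarse_cover cE) => -[E ? ?]; exists E.
have /choice[F FP] : forall i, exists E, EE E /\
    forall x, A x -> k x = i -> E (x0, x).
  move=> i; have [[x [Ax kx]]|nx] := pselect (exists x, A x /\ k x = i).
    have [E EE_ Ex] := pairE x; exists E; split=> // y Ay ky.
    by rewrite (kinj y x) // ky kx.
  have [E EE_ _] := pairE x0; exists E; split=> // y Ay ky.
  by case: nx; exists y.
have [T ET TF] := coarse_upper_bound m cE (fun i => proj1 (FP i)).
exists T => //; exists x0 => x Ax; apply/xsectionP.
by apply: (TF (k x)); [rewrite ltnS ltnW //; exact: km | exact: (FP (k x)).2].
Qed.

Lemma bounded_finite (X : Type) (EE : set (set (X * X))) (A : set X) :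
  finitary EE -> bounded EE A -> finite_set A.
Proof.
move=> fE [E EE_ [x sA]]; have [n En] := fE E EE_.
apply: sub_finite_set sA _; exact: card_le_finite (En x) (finite_II n).
Qed.

(** The counting step: (i, x) |-> (c i x, r i x) would embed n + 1 copies of the
   finite set [C] into n copies of it. *)
Lemma finite_no_shrinking_injection (X : Type) (C : set X) (n : nat)
    (r : nat -> X -> X) (c : nat -> X -> nat) :
  finite_set C -> C !=set0 ->
  (forall i x, i < n.+1 -> C x -> C (r i x) /\ c i x < n) ->
  (forall i j x y, i < n.+1 -> j < n.+1 -> C x -> C y ->
    r i x = r j y -> c i x = c j y -> i = j /\ x = y) ->
  False.
Proof.
move=> /finite_setP[m /card_eqPle[Cm mC]] [x0 Cx0] rc rc_inj.
have [k [km kinj]] := card_le_injection 0 Cm.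
have [e [eC einj]] := card_le_injection x0 mC.
have m_gt0 : 0 < m by apply: leq_ltn_trans (km _ Cx0).
pose cP (i : 'I_n.+1) (a : 'I_m) := (rc i _ (ltn_ord i) (eC a (ltn_ord a))).2.
pose rP (i : 'I_n.+1) (a : 'I_m) := km _ (rc i _ (ltn_ord i) (eC a (ltn_ord a))).1.
pose g (p : 'I_n.+1 * 'I_m) := (Ordinal (cP p.1 p.2), Ordinal (rP p.1 p.2)).
have /leq_card : injective g.
  move=> [i a] [j b] [eqc eqr].
  have Ca := eC _ (ltn_ord a); have Cb := eC _ (ltn_ord b).
  have [] := rc_inj i j (e a) (e b) (ltn_ord i) (ltn_ord j) Ca Cb _ eqc.
    by apply: kinj eqr; exact: (rc _ _ (ltn_ord _) _).1.
  move=> /val_inj -> /(einj _ _ (ltn_ord a) (ltn_ord b)) eqab.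
  by congr pair; exact: val_inj.
by rewrite !card_prod !card_ord leq_pmul2r // ltnn.
Qed.

(** The quantitative form of largeness: [A] has density at least 1/[n],
   as witnessed by the partition of X into the classes of [B]. *)
Definition cellularly_dense {X : Type} (EE : set (set (X * X))) (n : nat)
    (A : set X) (B : set (X * X)) :=
  [/\ EE B, cellular_entourage B, forall x, exists2 a, A a & B (x, a)
    & forall x, xsection B x #<= `I_n].

Lemma large_cellularly_dense (X : Type) (EE : set (set (X * X))) (A : set X) :
  large EE -> finitary EE -> cellular EE -> infinite_set A ->
  exists n B, cellularly_dense EE n A B.
Proof.
move=> [_ lE] fE [BB [sBB baseB] cB] Ainf.
have [E EE_ EA] := lE A (fun bA => Ainf (bounded_finite fE bA)).
have [B BB_ sEB] := baseB E EE_.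
have [n Bn] := fE B (sBB B BB_).
exists n, B; split=> //; [exact: sBB | exact: cB |].
move=> x; have : [set: X] x := I.
rewrite -EA => -[a Aa /xsectionP Eax]; exists a => //.
have [_ symB _] := cB B BB_; exact: symB (sEB _ Eax).
Qed.

(** In a class C of a common coarsening of the first n + 1 relations that avoids
   the pairwise intersections of the first n + 1 sets, send y to a point r (i, y) of [A i] in the
   i-th class of y, and record which of the at most n points of that class y is.
   The point r (i, y) determines i, by disjointness inside C, and then with the
   record it determines y: this is the map excluded by
   [finite_no_shrinking_injection]. *)
Lemma no_almost_disjoint_dense (X : Type) (EE : set (set (X * X)))
    (A : nat -> set X) (n : nat) :
  infinite_set [set: X] -> coarse_structure EE -> finitary EE -> cellular EE ->
  (forall i, exists B, cellularly_dense EE n (A i) B) ->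
  ~ (forall i j, i <> j -> finite_set (A i `&` A j)).
Proof.
move=> Xinf cE fE [BB [sBB baseB] cB] /choice[F FP] disjA.
have [T ET FT] := coarse_upper_bound n cE
  (fun i => let: And4 EF _ _ _ := FP i in EF).
have [B BB_ sTB] := baseB T ET.
have eqB := cB B BB_; have [reflB symB trB] := eqB.
have classfin x : finite_set (xsection B x).
  have [k Bk] := fE B (sBB B BB_); exact: card_le_finite (Bk x) (finite_II k).
pose D := \bigcup_(i in `I_n.+1) \bigcup_(j in `I_n.+1 `\ i) (A i `&` A j).
have Dfin : finite_set D.
  apply: bigcup_finite => [|i _]; first exact: finite_II.
  apply: bigcup_finite => [|j [_ ji]]; first exact/finite_setD/finite_II.
  by apply: disjA => ij; apply: ji; rewrite ij.
have [x nDx] : exists x, ~ (\bigcup_(d in D) xsection B d) x.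
  apply: contrapT => /forallNP allD; apply: Xinf.
  apply: sub_finite_set (bigcup_finite Dfin (fun d _ => classfin d)).
  by move=> x _; apply: contrapT; exact: allD.
have Bx_notD y : B (x, y) -> ~ D y.
  by move=> Bxy Dy; apply: nDx; exists y => //; apply/xsectionP; exact: symB.
have /choice[r rP] : forall iy : nat * X, exists a, A iy.1 a /\ F iy.1 (iy.2, a).
  by move=> [i y]; have [_ _ /(_ y)[a ? ?] _] := FP i; exists a.
have /choice[c cP] : forall iz : nat * X, exists f : X -> nat,
    [/\ forall y, F iz.1 (iz.2, y) -> f y < n
      & forall y z, F iz.1 (iz.2, y) -> F iz.1 (iz.2, z) -> f y = f z -> y = z].
  move=> [i z] /=; have [_ _ _ /(_ z)/(card_le_injection 0)[f [fn finj]]] := FP i.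
  exists f; split=> [y /xsectionP|y w /xsectionP ? /xsectionP ?]; [exact: fn|exact: finj].
have symF i y z : F i (y, z) -> F i (z, y).
  by have [_ [_ sym _] _ _] := FP i; exact: sym.
have rF i y : F i (r (i, y), y) by apply/symF/(rP (i, y)).2.
have rB i y : i < n.+1 -> B (x, y) -> B (x, r (i, y)).
  move=> lt_in Bxy; apply: trB Bxy _; apply/sTB/(FT i) => //.
  exact: (rP (i, y)).2.
apply: (@finite_no_shrinking_injection X (xsection B x) n
  (fun i y => r (i, y)) (fun i y => c (i, r (i, y)) y)).
- exact: classfin.
- by exists x; apply/xsectionP; exact: reflB.
- move=> i y lt_in /xsectionP Bxy; split; first by apply/xsectionP; exact: rB.
  by have [cn _] := cP (i, r (i, y)); apply: cn; exact: rF.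
- move=> i j y z lt_in lt_jn /xsectionP Bxy /xsectionP Bxz eqr.
  have eqij : i = j.
    apply: contrapT => nij; apply: (Bx_notD (r (i, y))); first exact: rB.
    exists i => //; exists j; first by split=> //= ji; apply: nij.
    by split; [exact: (rP (i, y)).1 | rewrite eqr; exact: (rP (j, z)).1].
  rewrite -eqij in eqr *; rewrite -eqr => eqc; split=> //.
  have [_ cinj] := cP (i, r (i, y)).
  by apply: cinj eqc; [exact: rF | rewrite /= eqr; exact: rF].
Qed.

(** If all fibers were finite, the set of binary sequences would be countable;
   the diagonal sequence [d] built from an injection [k] into nat refutes
   this. *)
Lemma uncountable_infinite_fiber (h : (nat -> bool) -> nat) :
  exists n, infinite_set [set f | h f = n].
Proof.
apply: contrapT => /forallNP hfin.
have /countable_injP[k kinj] : countable [set: nat -> bool].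
  apply: (@sub_countable _ _ _ (\bigcup_(n in [set: nat]) [set f | h f = n])).
    by apply: subset_card_le => f _; exists (h f).
  apply: bigcup_countable => // n _; apply: finite_set_countable.
  exact: contrapT (hfin n).
have kI f g : k f = k g -> f = g by apply: kinj; rewrite in_setT.
pose d i := `[< exists2 f, k f = i & f i = false >].
case dk : (d (k d)).
  by have /asboolP[f /kI ->] := dk; rewrite dk.
by move/negbT/asboolPn: (dk); apply; exists d.
Qed.

(** The branch of the binary tree along [f], the node with label word w being
   represented by the point [e (pickle w)] of X. *)
Definition prefixes {X : Type} (e : nat -> X) (f : nat -> bool) : set X :=
  range (fun k => e (pickle (mkseq f k))).

Lemma infinite_prefixes (X : Type) (e : nat -> X) f :
  injective e -> infinite_set (prefixes e f).
Proof.
move=> einj; rewrite /prefixes.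
set q := fun k => _; have qinj : injective q.
  move=> k l /einj/(pcan_inj pickleK)/(congr1 size).
  by rewrite !size_mkseq.
apply/infiniteP; have /card_eqPle[] // : range q #= [set: nat].
exact: inj_card_eq (in2W qinj).
Qed.

(** If f and g differ at m, their common prefixes have length at most m. *)
Lemma prefixes_almost_disjoint (X : Type) (e : nat -> X) f g :
  injective e -> f <> g -> finite_set (prefixes e f `&` prefixes e g).
Proof.
move=> einj nfg.
have [m fgm] : exists m, f m <> g m.
  by apply/existsNP => fg; apply: nfg; exact/funext.
apply: (@sub_finite_set _ _ ((fun k => e (pickle (mkseq f k))) @` `I_m.+1)).
  move=> _ [[k _ <-] [l _ /einj /(pcan_inj pickleK) eqs]]; exists k => //=.
  have eqkl : l = k by rewrite -(size_mkseq f k) -eqs size_mkseq.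
  rewrite ltnNge; apply/negP => lt_mk; apply: fgm.
  by rewrite -(nth_mkseq false f lt_mk) -eqs eqkl nth_mkseq.
exact/finite_image/finite_II.
Qed.

Theorem theorem2p9 (X : Type) (EE : set (set (X * X))) :
  [set: X] !=set0 ->
  coarse_structure EE -> large EE -> finitary EE -> ~ cellular EE.
Proof.
move=> [x0 _] cE lE fE cellE.
have Xinf : infinite_set [set: X].
  by move=> /(finite_bounded x0 cE); exact: lE.1.
have [e [_ einj']] := card_le_injection x0 (proj1 (infiniteP _) Xinf).
have einj : injective e by move=> i j; exact: einj'.
have /choice[h hP] f : exists n, exists B, cellularly_dense EE n (prefixes e f) B.
  exact/large_cellularly_dense/infinite_prefixes.
have [n /infiniteP] := uncountable_infinite_fiber h.
case/(card_le_injection (fun=> false)) => F [Fn Finj].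
apply: (@no_almost_disjoint_dense X EE (fun i => prefixes e (F i)) n) => // [i|i j nij].
  by rewrite -(Fn i).
by apply: prefixes_almost_disjoint => // /(Finj _ _ I I).
Qed.
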